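(* If there exists an infinite cardinal $\lambda$ such that $\kappa:=2^{2^{2^{\lambda}}}$ is a finite successor of $\lambda$ (i.e., $\kappa=\lambda^{+n}$ for some $n<\omega$), then $E^\kappa_\omega:=\{\delta<\kappa\mid\operatorname{cf}(\delta)=\omega\}$ carries an $\omega$-bounded ladder system $\vec L$ (that is, there is an $\omega$-bounded ladder system $\vec L$ over $E^\kappa_\omega$) for which $X_{\vec L}$ is not countably metacompact. In particular, if $2^{2^{2^{\aleph_0}}}<\aleph_\omega$, then the conclusion holds for $\kappa:=2^{2^{2^{\aleph_0}}}$.
   Context: Work in ZFC. $\lambda^{+n}$ denotes the $n$-th cardinal after $\lambda$. Let $\kappa$ be a regular uncountable cardinal. A ladder system over a stationary subset $S$ of $\kappa$ is a sequence $\vec L=\langle A_\delta\mid\delta\in S\rangle$ such that each $A_\delta$ is a cofinal subset of $\delta$. It is $\xi$-bounded iff $\operatorname{otp}(A_\delta)\le\xi$ for all $\delta\in S$. The topological space $X_{\vec L}$ has underlying set $(\kappa\times\{0\})\cup(S\times\{1\})$; all points of $\kappa\times\{0\}$ are isolated and, for every $\delta\in S$, the (basic) neighborhoods of $(\delta,1)$ are the sets of the form $(A\times\{0\})\cup\{(\delta,1)\}$ for $A$ an end segment of $A_\delta$. A topological space $X$ is countably metacompact iff for every decreasing sequence $\langle D_n\mid n<\omega\rangle$ of closed subsets of $X$ with empty intersection, there is a decreasing sequence $\langle U_n\mid n<\omega\rangle$ of open subsets of $X$ with empty intersection such that $D_n\subseteq U_n$ for all $n<\omega$. *)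

(* Defs.v *)
From HB Require Import structures.
From mathcomp Require Import all_boot all_order.
From mathcomp Require Import boolp classical_sets functions cardinality filter.
From mathcomp Require Import topology.

Set Implicit Arguments.
Unset Strict Implicit.
Unset Printing Implicit Defensive.

Import Order.TTheory.

Local Open Scope classical_set_scope.
Local Open Scope order_scope.
Local Open Scope card_scope.

(** Cardinals are represented by types up to equipotence, so that [2 ^ lambda]
    is [set Lambda] for [Lambda] of cardinality [lambda]; ordinals are
    represented by well-founded total orders up to isomorphism. *)

Definition card_lt (T U : Type) (A : set T) (B : set U) : Prop :=
  A #<= B /\ ~ (B #<= A).

Notation "A '#<' B" := (card_lt A B)
  (at level 79, format "A  '#<'  B") : card_scope.

Definition succ_card (A B : Type) : Prop :=
  [set: A] #< [set: B] /\
  forall C : Type, [set: A] #< [set: C] -> [set: B] #<= [set: C].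

Fixpoint nth_succ_card (n : nat) (A B : Type) : Prop :=
  if n is m.+1 then exists2 C : Type, nth_succ_card m A C & succ_card C B
  else [set: A] #= [set: B].

Definition aleph (n : nat) (A : Type) : Prop := nth_succ_card n nat A.

(** [aleph_omega A] : the cardinality of [A] is the supremum of the [aleph_n]. *)
Definition aleph_omega (A : Type) : Prop :=
  (forall (n : nat) (B : Type), aleph n B -> [set: B] #<= [set: A]) /\
  (forall C : Type,
    (forall (n : nat) (B : Type), aleph n B -> [set: B] #<= [set: C]) ->
    [set: A] #<= [set: C]).

(** The elements of [K] are the ordinals below the cardinal represented by
    [K]; the element [x] is the ordinal [[set y | y < x]]. *)
Definition initial_ordinal d (K : orderType d) : Prop :=
  well_founded (fun x y : K => x < y) /\
  forall x : K, [set y | y < x] #< [set: K].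

Definition otp_le d (K : orderType d) d' (W : orderType d')
    (A : set K) (B : set W) : Prop :=
  exists f : A -> B,
    (forall x y : A, (val (f x) < val (f y)) = (val x < val y)) /\
    (forall (x : A) (b : B), val b < val (f x) -> exists y : A, f y = b).

Definition otp_eq d (K : orderType d) d' (W : orderType d')
    (A : set K) (B : set W) : Prop :=
  exists f : A -> B,
    (forall x y : A, (val (f x) < val (f y)) = (val x < val y)) /\
    (forall b : B, exists y : A, f y = b).

Section Ordinals.
Context {d : Order.disp_t} {K : orderType d}.
Implicit Types (A B C D S : set K) (x y z : K).

Definition below x : set K := [set y | y < x].

Definition cofinal_in D A : Prop :=
  A `<=` D /\ forall x, D x -> exists2 a, A a & x <= a.

(** [cf D B] : the cofinality of [otp(D)] is [otp(B)]. *)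
Definition cf D d' (W : orderType d') (B : set W) : Prop :=
  (exists2 A, cofinal_in D A & otp_eq A B) /\
  (forall A, cofinal_in D A -> otp_le B A).

Definition regular_uncountable : Prop :=
  [/\ initial_ordinal K, cf [set: K] [set: K] & ~ countable [set: K]].

Definition club C : Prop :=
  cofinal_in [set: K] C /\
  forall x, (exists y, y < x) ->
    (forall y, y < x -> exists2 c, C c & y < c < x) -> C x.

Definition stationary S : Prop := forall C, club C -> S `&` C !=set0.

Definition ladder_system S (L : S -> set K) : Prop :=
  [/\ regular_uncountable, stationary S &
      forall delta : S, cofinal_in (below (val delta)) (L delta)].

Definition bounded_ladder d' (W : orderType d') (xi : set W)
    S (L : S -> set K) : Prop :=
  forall delta : S, otp_le (L delta) xi.

(** The second clause excludes the empty end segment (unless [A] is empty), as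
    otherwise [(delta, 1)] would be an isolated point of the space below. *)
Definition end_segment A B : Prop :=
  [/\ B `<=` A, A !=set0 -> B !=set0 &
      forall x y, B x -> A y -> x <= y -> B y].

Lemma end_segment_refl A : end_segment A A.
Proof. by split. Qed.

Lemma end_segmentI A B C :
  end_segment A B -> end_segment A C -> end_segment A (B `&` C).
Proof.
move=> [BA B0 Bup] [CA C0 Cup]; split.
- by move=> x [/BA].
- move=> A0; have [b Bb] := B0 A0; have [c Cc] := C0 A0.
  have [bc|cb] := leP b c.
    by exists c; split => //; apply: (Bup b) => //; exact: CA.
  by exists b; split => //; apply: (Cup c) => //; [exact: BA | exact: ltW].
- by move=> x y [Bx Cx] Ay xy; split; [exact: (Bup x) | exact: (Cup x)].
Qed.

(** [inl alpha] is the point [(alpha, 0)], [inr delta] the point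
    [(delta, 1)]. *)
Definition ladder_space S (L : S -> set K) : Type := (K + S)%type.

Definition basic_nbhd S (L : S -> set K) (delta : S) A
    : set (ladder_space L) :=
  inl @` A `|` [set inr delta].

Definition ladder_nbhs S (L : S -> set K) (p : ladder_space L)
    : set (set (ladder_space L)) :=
  match p with
  | inl alpha => [set U | U (inl alpha)]
  | inr delta => [set U | exists2 A, end_segment (L delta) A &
                                     @basic_nbhd S L delta A `<=` U]
  end.

End Ordinals.

Arguments regular_uncountable {d} K.

HB.instance Definition _ d (K : orderType d) (S : set K) (L : S -> set K) :=
  Choice.copy (ladder_space L) (K + S)%type.

HB.instance Definition _ d (K : orderType d) (S : set K) (L : S -> set K) :=
  hasNbhs.Build (ladder_space L) (@ladder_nbhs d K S L).

Section LadderTopology.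
Context {d : Order.disp_t} {K : orderType d} (S : set K) (L : S -> set K).
Implicit Types (p : ladder_space L) (U : set (ladder_space L)).

Let ladder_nbhs_filter p : ProperFilter (nbhs p).
Proof.
case: p => [alpha|delta]; apply: Build_ProperFilter_ex.
- by move=> U Ua; exists (inl alpha).
- by split=> // U V UV /UV.
- by move=> U [A _ AU]; exists (inr delta); apply: AU; right.
- split.
  + by exists (L delta) => //; exact: end_segment_refl.
  + move=> U V [A LA AU] [B LB BV]; exists (A `&` B).
      exact: end_segmentI.
    move=> _ [[x [Ax Bx] <-]|->]; last by split; [apply: AU|apply: BV]; right.
    by split; [apply: AU|apply: BV]; left; exists x.
  + by move=> U V UV [A LA AU]; exists A => // q /AU/UV.
Qed.

Let ladder_nbhs_singleton p U : nbhs p U -> U p.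
Proof. by case: p => [//|delta] [A _]; apply; right. Qed.

Let ladder_nbhs_nbhs p U : nbhs p U -> nbhs p (nbhs^~ U).
Proof.
case: p => [//|delta] [A LA AU]; exists A => // _ [[x Ax <-]|->].
  by apply: AU; left; exists x.
by exists A.
Qed.

HB.instance Definition _ := Nbhs_isNbhsTopological.Build (ladder_space L)
  ladder_nbhs_filter ladder_nbhs_singleton ladder_nbhs_nbhs.

End LadderTopology.

Definition countably_metacompact (X : topologicalType) : Prop :=
  forall D : nat -> set X,
    (forall n, closed (D n)) -> (forall n, D n.+1 `<=` D n) ->
    \bigcap_n D n = set0 ->
    exists U : nat -> set X,
      [/\ forall n, open (U n), forall n, U n.+1 `<=` U n,
          \bigcap_n U n = set0 & forall n, D n `<=` U n].

Definition E_omega d (K : orderType d) : set K :=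
  [set delta | cf (below delta) [set: nat]].

Arguments E_omega {d} K.

Definition E_omega_carries_non_metacompact d (K : orderType d) : Prop :=
  exists L : E_omega K -> set K,
    [/\ ladder_system L, bounded_ladder [set: nat] L &
        ~ countably_metacompact (ladder_space L)].

(* Main.v *)
(** Put [T = 2 ^ Lambda] and [K = chi ^ +], so that [K = 2 ^ (2 ^ T)] and, by
    Hausdorff's formula, [chi ^ T = chi].

    First, each [delta] in [K] has at most [T] many sequences [a delta c]
    converging to it such that, for all [G : K -> K], some set of [T] many points
    whose limits are closed under [G] has all its convergent sequences among
    them. With [chi] many sequences at [delta] this is trivial, and one descends
    from each cardinal to its predecessor until [T] is reached.

    By Engelking-Karlowicz there are functions [f k : K * K -> T * nat], for
    [2 ^ T] many [k], realizing every prescription of values at [T] many points.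
    For each [k] let the pair [f k (delta, h delta) = (c, m)] select the ladder
    [a delta c] and the value [m]; countable metacompactness yields [g k] on [K]
    that is eventually at least [m] on that ladder. All the [g k] are coded by a
    single [G : K -> K]. The trace of [G] on the [a delta c] takes only [chi]
    many values, so [h delta] can be chosen to survive the inequalities for [k]
    ranging over all indices only if many other points survive them as well.
    Prescribing values at these survivors, for all limits [delta] of the set
    given by the first part, yields a [k] for which [g k] exceeds any given [m]
    eventually on any given convergent sequence of that set. But as the set is
    uncountable, [g k] is constant on one of these sequences. *)

Require Import Defs.
From mathcomp Require Import all_boot all_order.
From mathcomp Require Import boolp classical_sets functions cardinality.
From mathcomp Require Import topology.
From mathcomp Require wochoice.

Set Implicit Arguments.
Unset Strict Implicit.
Unset Printing Implicit Defensive.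

Import Order.TTheory.

Local Open Scope classical_set_scope.
Local Open Scope card_scope.

(** * Embeddings between types as comparison of cardinals *)

Definition embeds (A B : Type) : Prop := exists f : A -> B, injective f.

Lemma sval_inj T (P : T -> Prop) : injective (sval : {x | P x} -> T).
Proof. by move=> [x Px] [y Py] /= xy; exact: eq_exist. Qed.

Lemma embeds_refl A : embeds A A.
Proof. by exists id. Qed.

Lemma embeds_trans B A C : embeds A B -> embeds B C -> embeds A C.
Proof. by move=> [f fI] [g gI]; exists (g \o f); exact: inj_comp. Qed.

Lemma embeds_setP T U (A : set T) (B : set U) :
  A #<= B <-> embeds {x | A x} {x | B x}.
Proof.
pose i V (C : set V) (u : {x | C x}) : C := SigSub (mem_set (svalP u)).
pose j V (C : set V) (u : C) : {x | C x} := exist _ (val u) (set_valP u).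
have iI V C : injective (@i V C) by move=> u v /(congr1 val) /= uv; exact: sval_inj.
have jI V C : injective (@j V C) by move=> u v /(congr1 sval) /= uv; exact: val_inj.
split=> [/card_leP[f]|[f fI]].
  exists (fun x => j _ _ (f (i _ _ x))) => x y /jI fxy; apply: iI.
  by apply: (@inj _ _ _ f) => //; rewrite inE.
apply/card_leP/injfunPex; exists (fun x => i _ _ (f (j _ _ x))) => // x y _ _ /iI.
by move=> /fI /jI.
Qed.

Lemma embedsP A B : [set: A] #<= [set: B] <-> embeds A B.
Proof.
pose i T (x : T) : {x | [set: T] x} := exist _ x I.
have iI T : injective (@i T) by move=> x y [].
rewrite embeds_setP; split=> -[f fI].
  by exists (fun x => sval (f (i A x))) => x y xy; exact: iI (fI _ _ (sval_inj xy)).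
by exists (fun x => i B (f (sval x))) => x y xy; exact: sval_inj (fI _ _ (iI _ _ _ xy)).
Qed.

Lemma embeds_sub T (P Q : T -> Prop) :
  (forall x, P x -> Q x) -> embeds {x | P x} {x | Q x}.
Proof.
move=> PQ; exists (fun u => exist Q (sval u) (PQ _ (svalP u))) => u v uv.
by apply: sval_inj; case: uv.
Qed.

Lemma embeds_sig T (P : T -> Prop) : embeds {x | P x} T.
Proof. by exists sval; exact: sval_inj. Qed.

Lemma embeds_ontoP A B (a0 : A) :
  embeds A B -> exists g : B -> A, forall a, exists b, g b = a.
Proof.
move=> [f fI].
exists (fun b => if pselect (exists a, f a = b) is left h then sval (cid h) else a0).
move=> a; exists (f a); case: pselect => [h|[]]; last by exists a.
by case: cid => a' /= /fI.
Qed.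

Lemma onto_embeds A B (g : B -> A) : (forall a, exists b, g b = a) -> embeds A B.
Proof.
by move=> /choice[f fK]; exists f; exact: can_inj fK.
Qed.

Lemma embeds_prod A B C D : embeds A B -> embeds C D -> embeds (A * C) (B * D).
Proof.
move=> [f fI] [g gI]; exists (fun p => (f p.1, g p.2)) => -[a c] [a' c'] /=.
by case=> /fI -> /gI ->.
Qed.

Lemma embeds_fun A B C : embeds B C -> embeds (A -> B) (A -> C).
Proof.
move=> [f fI]; exists (fun u => f \o u) => u v /funeqP uv.
by apply/funext => a; apply: fI; exact: uv.
Qed.

Lemma embeds_dom A B C (a : A) : embeds A B -> embeds (A -> C) (B -> C).
Proof.
move=> /(embeds_ontoP a)[g gO]; exists (fun u => u \o g) => u v /funeqP uv.
by apply/funext => x; have [b <-] := gO x; exact: uv.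
Qed.

Lemma embeds_set A B : embeds A B -> embeds (set A) (set B).
Proof.
move=> [f fI]; exists (image^~ f) => X Y XY.
by apply/seteqP; split=> x /(imageP f); rewrite (XY, =^~ XY) => -[y Yy /fI <-].
Qed.

Lemma embeds_set1 A : embeds A (set A).
Proof.
exists set1 => x y xy; have : [set x] x by [].
by rewrite xy.
Qed.

Lemma embeds_curry A B C : embeds (A -> B -> C) (A * B -> C).
Proof.
exists (fun u p => u p.1 p.2) => u v /funeqP uv.
by apply/funext => a; apply/funext => b; exact: (uv (a, b)).
Qed.

(** Each [a] goes to a chosen index together with its image under the injection belonging to that
    index. *)
Lemma embeds_cover A I D (P : I -> A -> Prop) :
  (forall a, exists i, P i a) -> (forall i, embeds {a | P i a} D) ->
  embeds A (I * D).
Proof.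
move=> /choice[i Pi] De; pose e j := sval (cid (De j)).
have eI j : injective (e j) by rewrite /e; case: cid.
exists (fun a => (i a, e (i a) (exist (P (i a)) a (Pi a)))) => a b [ab].
by move: (Pi a) (Pi b); rewrite -ab => pa pb /eI[].
Qed.

Lemma not_embeds_set A : ~ embeds (set A) A.
Proof.
move=> [f fI]; pose D := [set a | exists2 X, f X = a & ~ X a].
have nD : ~ D (f D) by move=> Df; case: (Df) => X /fI -> /(_ Df).
by apply: (nD); exists D.
Qed.

(** * Well-orders, recursion and comparability of cardinals *)

Definition wo T (R : T -> T -> Prop) : Prop :=
  [/\ well_founded R, forall x y z, R x y -> R y z -> R x z
    & forall x y, x = y \/ R x y \/ R y x].

Definition seg T (R : T -> T -> Prop) (x : T) : Type := {y | R y x}.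

Lemma wo_irr T (R : T -> T -> Prop) x : wo R -> ~ R x x.
Proof. by case=> wf _ _; elim/(well_founded_ind wf): x => x IH Rx; exact: (IH x). Qed.

Lemma wo_min T (R : T -> T -> Prop) (P : T -> Prop) :
  well_founded R -> (exists x, P x) ->
  exists2 x, P x & forall y, R y x -> ~ P y.
Proof.
move=> wf [x]; elim/(well_founded_ind wf): x => x IH Px.
have [[y Ryx Py]|n] := pselect (exists2 y, R y x & P y); first exact: IH Py.
by exists x => // y Ryx Py; apply: n; exists y.
Qed.

Lemma wf_of_min T (R : T -> T -> Prop) :
  (forall P : T -> Prop, (exists x, P x) ->
     exists2 x, P x & forall y, R y x -> ~ P y) -> well_founded R.
Proof.
move=> min x; apply: contrapT => nx.
have [y ny ymin] := min (fun x => ~ Acc R x) (ex_intro _ x nx).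
by apply: ny; constructor => z /ymin /contrapT.
Qed.

Lemma exists_wo T : exists R : T -> T -> Prop, wo R.
Proof.
have [R Rwo] := wochoice.well_ordering_principle {classic T}.
have Rch : wochoice.wo_chain R predT by move=> C _; exact: Rwo.
have Rr x : R x x by exact: (wochoice.wo_chain_reflexive Rch).
have Ra : antisymmetric R.
  by move=> x y; exact: (wochoice.wo_chain_antisymmetric Rch).
have Rt x y : R x y || R y x by exact: (wochoice.wo_chainW Rch).
have Rmin (P : T -> Prop) : (exists x, P x) ->
    exists2 x, P x & forall y, P y -> R x y.
  move=> [x Px]; have [|z [[zP zmin] _]] := Rwo (fun x => `[< P x >]).
    by exists x; apply/asboolP.
  exists z; first exact/asboolP.
  by move=> y Py; apply: zmin; apply/asboolP.
exists (fun x y => R x y /\ x <> y); split.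
- apply: wf_of_min => P /Rmin[x Px xmin]; exists x => // y [Ryx yx] /xmin Rxy.
  by apply: yx; apply: Ra; rewrite Ryx.
- move=> x y z [Rxy xy] [Ryz yz].
  have [w] : exists2 w, w = x \/ w = y \/ w = z &
      forall t, t = x \/ t = y \/ t = z -> R w t.
    by apply: (Rmin (fun w => w = x \/ w = y \/ w = z)); exists x; left.
  move=> -[|[|]] -> h.
  + split; first by apply: h; auto.
    by move=> xz; apply: yz; apply: Ra; rewrite Ryz -xz.
  + by case: xy; apply: Ra; rewrite Rxy h//; left.
  + by case: yz; apply: Ra; rewrite Ryz h//; right; left.
- move=> x y; have [->|xy] := pselect (x = y); first by left.
  have /orP[Rxy|Ryx] := Rt x y; first by right; left.
  by right; right; split=> // yx; apply: xy.
Qed.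

Lemma wo_pullback S T (R : T -> T -> Prop) (f : S -> T) :
  injective f -> wo R -> wo (fun x y => R (f x) (f y)).
Proof.
move=> fI [wf tr tot]; split.
- apply: wf_of_min => P [x Px].
  have [|_ [z <- Pz] zmin] := @wo_min _ _ (fun t => exists2 z, f z = t & P z) wf.
    by exists (f x), x.
  by exists z => // y Ry Py; apply: (zmin (f y)) => //; exists y.
- by move=> x y z; exact: tr.
- by move=> x y; have [/fI|] := tot (f x) (f y); [left|right].
Qed.

Definition lex S T (Q : S -> S -> Prop) (R : T -> T -> Prop) (p q : S * T) :=
  Q p.1 q.1 \/ p.1 = q.1 /\ R p.2 q.2.

Lemma wo_lex S T (Q : S -> S -> Prop) (R : T -> T -> Prop) :
  wo Q -> wo R -> wo (lex Q R).
Proof.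
move=> [Qwf Qtr Qtot] [Rwf Rtr Rtot]; split.
- apply: wf_of_min => P [[a b] Pab].
  have [|s [t Pst] smin] := @wo_min _ _ (fun s => exists t, P (s, t)) Qwf.
    by exists a, b.
  have [|u Psu umin] := @wo_min _ _ (fun t => P (s, t)) Rwf; first by exists t.
  exists (s, u) => // -[c e] [/= Qc Pc|/= [-> Re]]; last exact: umin.
  by apply: (smin c) => //; exists e.
- move=> [x1 x2] [y1 y2] [z1 z2]; rewrite /lex /=.
  move=> [Q1|[-> R1]] [Q2|[<- R2]]; [left|left|left|right] => //.
    exact: Qtr Q2.
  by split=> //; exact: Rtr R2.
- move=> [x1 x2] [y1 y2]; rewrite /lex /=.
  have [->|[|]] := Qtot x1 y1; [|by auto|by auto].
  have [->|[|]] := Rtot x2 y2; [by auto|by auto|by auto].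
Qed.

(** Recursion with a choice at each step. The extensionality hypothesis says that [P x f] depends
    only on [f] below [x], so the values not yet defined can be filled with a default; where no
    choice is possible the value is arbitrary. *)
Lemma rec_choice T U (R : T -> T -> Prop) (P : T -> (T -> U) -> U -> Prop) :
  well_founded R -> U ->
  (forall x f g u, (forall y, R y x -> f y = g y) -> P x f u -> P x g u) ->
  exists f : T -> U, forall x, (exists u, P x f u) -> P x f (f x).
Proof.
move=> wf u0 Pext.
pose ext x (r : forall y, R y x -> U) y :=
  if pselect (R y x) is left h then r y h else u0.
pose F x (r : forall y, R y x -> U) :=
  if pselect (exists u, P x (ext x r) u) is left h then sval (cid h) else u0.
pose f := Fix wf (fun=> U) F.
have fE x : f x = F x (fun y _ => f y).
  rewrite /f Fix_eq// => {}x r r' rr'; congr F.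
  by apply/functional_extensionality_dep => y; apply/funext => h; exact: rr'.
exists f => x [u Pu].
have extE y : R y x -> ext x (fun y _ => f y) y = f y.
  by rewrite /ext; case: pselect.
rewrite fE /F; case: pselect => [h|[]].
  by case: cid => v /=; apply: Pext.
by exists u; apply: Pext Pu => y /extE.
Qed.

(** Values in [B] distinct from all earlier ones are chosen along a well-order of [A]. Either this
    never fails and gives an injection, or it fails at some [x] and [f] is onto [B]. *)
Lemma embeds_total A B : embeds A B \/ embeds B A.
Proof.
have [b0|nB] := pselect (exists b : B, True); last first.
  right; have F (b : B) : False by apply: nB; exists b.
  by exists (fun b => False_rect A (F b)) => b; case: (F b).
case: b0 => b0 _.
have [R [wf tr tot]] := exists_wo A.
have [|f fP] := @rec_choice A B R (fun x f b => forall y, R y x -> f y <> b) wf b0.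
  by move=> x f g u fg h y Ryx; rewrite -fg//; exact: h.
have [h|/existsNP[x nx]] := pselect (forall x, exists b, forall y, R y x -> f y <> b).
  left; exists f => x y fxy; have [//|[Rxy|Ryx]] := tot x y.
    by have := fP y (h y) x Rxy.
  by have := fP x (h x) y Ryx; rewrite fxy.
right; apply: (onto_embeds (g := f)) => b; apply: contrapT => nb.
by apply: nx; exists b => y _ fyb; apply: nb; exists y.
Qed.

(** * Infinite cardinals and their squares *)

Definition infinite (A : Type) : Prop := embeds nat A.

Lemma infinite_inhabited A : infinite A -> A.
Proof. by move=> /cid[f _]; exact: f 0. Qed.

Lemma infinite_setTP A : infinite_set [set: A] <-> infinite A.
Proof. by rewrite infiniteP embedsP. Qed.

(** A shift along a copy of [nat] in [A] vacates [f 0], which receives [None]. *)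
Lemma embeds_option A : infinite A -> embeds (option A) A.
Proof.
move=> [f fI].
pose g a := if pselect (exists n, f n = a) is left h then f (sval (cid h)).+1 else a.
have gf n : g (f n) = f n.+1.
  rewrite /g; case: pselect => [h|[]]; last by exists n.
  by case: cid => m /= /fI ->.
have gN a : ~ (exists n, f n = a) -> g a = a by rewrite /g; case: pselect.
have g0 a : g a <> f 0.
  have [[n <-]|na] := pselect (exists n, f n = a); first by rewrite gf => /fI.
  by rewrite gN// => a0; apply: na; exists 0.
have gI : injective g.
  move=> a b.
  have [[n <-]|na] := pselect (exists n, f n = a);
    have [[m <-]|nb] := pselect (exists n, f n = b); rewrite ?gf ?gN//.
  - by move=> /fI[->].
  - by move=> nE; case: nb; exists n.+1.
  - by move=> mE; case: na; exists m.+1.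
exists (fun o => if o is Some a then g a else f 0) => -[a|] [b|] //.
- by move=> /gI ->.
- by move=> /g0.
- by move=> /esym /g0.
Qed.

Lemma infinite_option A : infinite (option A) -> infinite A.
Proof.
move=> [f fI].
have [N fN] : exists N, forall n, f (n + N) <> None.
  have [[m fm]|nN] := pselect (exists m, f m = None); last first.
    by exists 0 => n fn; apply: nN; exists (n + 0).
  exists m.+1 => n fn; have /fI nm : f (n + m.+1) = f m by rewrite fn fm.
  by have := leq_addl n m.+1; rewrite nm ltnn.
have [g gE] : {g : nat -> A & forall n, f (n + N) = Some (g n)}.
  apply: (@choice _ _ (fun n a => f (n + N) = Some a)) => n.
  by case fE : (f (n + N)) => [a|]; [exists a|case: (fN n)].
by exists g => n m nm; apply: (@addIn N); apply: fI; rewrite !gE nm.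
Qed.

Lemma infinite_prod A : infinite (A * A) -> infinite A.
Proof.
rewrite -!infinite_setTP => inf fin; apply: inf.
by rewrite -setXTT; exact: finite_setX.
Qed.

Lemma embeds_closed_seg T (R : T -> T -> Prop) x :
  wo R -> embeds {y | ~ R x y} (option (seg R x)).
Proof.
move=> [_ _ tot].
exists (fun u => if pselect (R (sval u) x) is left h
                 then Some (exist (fun y => R y x) (sval u) h) else None).
move=> u v; case: pselect => hu; case: pselect => hv // e; apply: sval_inj.
  by case: e.
have [uv|[//|vu]] := tot (sval u) x; have [vx|[//|xv]] := tot (sval v) x.
- by rewrite uv vx.
- by case: (svalP v).
- by case: (svalP u).
- by case: (svalP u).
Qed.

Definition square (A : Type) : Prop := embeds (A * A) A.

(** The order of type [|T|] on [T * T] used is Goedel's: first by the maximum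
    of the two components, then lexicographically. *)
Lemma square_of_segs T (R : T -> T -> Prop) :
  wo R -> infinite T -> (forall x, infinite (seg R x) -> square (seg R x)) ->
  square T.
Proof.
move=> Rwo Tinf IH; have [wf tr tot] := Rwo.
(* If [T] embeds in a proper segment, the hypothesis on that segment suffices. Afterwards no proper
   segment is as large as [T]. *)
have [[x Tx]|nT] := pselect (exists x, embeds T (seg R x)).
  have /IH sx : infinite (seg R x) by exact: embeds_trans Tx.
  apply: embeds_trans (embeds_sig _).
  by apply: embeds_trans sx; exact: embeds_prod.
pose mx (p : T * T) := if pselect (R p.1 p.2) is left _ then p.2 else p.1.
have mxP p : ~ R (mx p) p.1 /\ ~ R (mx p) p.2.
  rewrite /mx; case: pselect => [lt|nlt]; split=> //; try exact: wo_irr.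
  by move=> /(tr _ _ _ lt); exact: wo_irr.
pose code (p : T * T) := (mx p, p).
have codeI : injective code by move=> p q [].
pose Q := fun p q => lex R (lex R R) (code p) (code q).
have Qwo : wo Q by exact: wo_pullback codeI (wo_lex Rwo (wo_lex Rwo Rwo)).
have [Qwf Qtr Qtot] := Qwo.
have segQ p : ~ embeds T (seg Q p).
  set m := mx p => TQ.
  pose le := {y | ~ R m y}.
  (* A [Q]-predecessor of [p] has both components at most [m], so it lies in the square of a closed
     segment, which is too small to contain [T]. *)
  have Qle : embeds (seg Q p) (le * le).
    have Qm q : Q q p -> ~ R m q.1 /\ ~ R m q.2.
      have [n1 n2] := mxP q; case=> [/= qp|[/= mE _]]; last first.
        by rewrite /m -mE.
      by split=> mq; [apply: n1|apply: n2]; exact: tr mq.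
    exists (fun u => (exist _ (sval u).1 (Qm _ (svalP u)).1,
                      exist _ (sval u).2 (Qm _ (svalP u)).2)) => u v [].
    by move=> e1 e2; apply: sval_inj; case: (sval u) (sval v) e1 e2 => ? ? [] ? ? /= -> ->.
  have le_opt : embeds le (option (seg R m)) by exact: embeds_closed_seg.
  have le_inf : infinite le.
    by apply: infinite_prod; apply: embeds_trans Qle; exact: embeds_trans TQ.
  have seg_inf : infinite (seg R m).
    by apply: infinite_option; exact: embeds_trans le_opt.
  apply: nT; exists m; apply: embeds_trans TQ _; apply: embeds_trans Qle _.
  have le_seg : embeds le (seg R m).
    exact: embeds_trans (embeds_option seg_inf).
  by apply: embeds_trans (IH _ seg_inf); exact: embeds_prod.
have [|f fP] := @rec_choice (T * T) T Q
    (fun p f t => forall q, Q q p -> f q <> t) Qwf (infinite_inhabited Tinf).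
  by move=> p f g t fg h q Qqp; rewrite -fg//; exact: h.
have {}fP p : forall q, Q q p -> f q <> f p.
  apply: fP; apply: contrapT => nt; apply: (segQ p).
  apply: (onto_embeds (g := f \o sval)) => t; apply: contrapT => nf.
  apply: nt; exists t => q Qqp fq; apply: nf.
  by exists (exist (fun q => Q q p) q Qqp).
exists f => p q fpq; have [//|[pq|qp]] := Qtot p q.
  by case: (fP _ _ pq).
by case: (fP _ _ qp).
Qed.

(** Well-founded induction on segments: a segment of [seg R x] is equipotent with a segment of [T]
    at an earlier point. *)
Lemma infinite_square T : infinite T -> square T.
Proof.
move=> Tinf; have [R Rwo] := exists_wo T; have [wf tr _] := Rwo.
apply: (square_of_segs Rwo) => // {Tinf}.
elim/(well_founded_ind wf) => x IH xinf.
pose Rx (u v : seg R x) := R (sval u) (sval v).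
have Rxwo : wo Rx by exact: wo_pullback (@sval_inj _ _) Rwo.
apply: (square_of_segs Rxwo) => // u.
have to_seg : embeds (seg Rx u) (seg R (sval u)).
  exists (fun v => exist (fun y => R y (sval u)) (sval (sval v)) (svalP v)) => v w vw.
  by apply: sval_inj; apply: sval_inj; case: vw.
have of_seg : embeds (seg R (sval u)) (seg Rx u).
  exists (fun v => exist (fun y => Rx y u)
    (exist (fun y => R y x) (sval v) (tr _ _ _ (svalP v) (svalP u))) (svalP v)).
  by move=> v w vw; apply: sval_inj; case: vw.
move=> uinf; apply: embeds_trans of_seg.
apply: embeds_trans (IH _ (svalP u) _); first exact: embeds_prod.
exact: embeds_trans to_seg.
Qed.

(** * Successor cardinals: regularity and exponentiation *)

Lemma embeds_prod_id A B C : infinite C -> embeds A C -> embeds B C -> embeds (A * B) C.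
Proof.
move=> Cinf AC BC; apply: embeds_trans (infinite_square Cinf).
exact: embeds_prod.
Qed.

(** If the family were unbounded, the closed segments at the [f i] would cover [T], giving [T] at
    most [A * A], that is [A], many elements. *)
Lemma bounded_family T (R : T -> T -> Prop) A I (f : I -> T) :
  wo R -> (forall x, embeds (seg R x) A) -> infinite A -> ~ embeds T A ->
  embeds I A -> exists b, forall i, R (f i) b.
Proof.
move=> Rwo segA Ainf TA IA; apply: contrapT => nb; apply: TA.
apply: embeds_trans (embeds_prod_id Ainf IA (embeds_option Ainf)).
apply: (embeds_cover (P := fun i b => ~ R (f i) b)).
  by move=> b; apply: contrapT => /forallNP nR; apply: nb; exists b => i; apply: contrapT.
move=> i; apply: embeds_trans (embeds_closed_seg _ Rwo) _.
have [g gI] := segA (f i).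
by exists (omap g) => -[u|] [v|] //= [/gI ->].
Qed.

Lemma succ_cardP A B : succ_card A B ->
  [/\ embeds A B, ~ embeds B A & forall C, ~ embeds C A -> embeds B C].
Proof.
move=> [[/embedsP AB BA] BC]; split=> //; first by rewrite -embedsP.
move=> C CA; apply/embedsP/BC; split; last by rewrite embedsP.
by apply/embedsP; have [] := embeds_total A C.
Qed.

(** The least segment into which [T] embeds, if any, lends its order to [T]. *)
Lemma exists_initial_wo T :
  exists2 R : T -> T -> Prop, wo R & forall x, ~ embeds T (seg R x).
Proof.
have [R Rwo] := exists_wo T; have [wf tr _] := Rwo.
have [[x0 Tx0]|nT] := pselect (exists x, embeds T (seg R x)); last first.
  by exists R => // x Tx; apply: nT; exists x.
have [|x [j jI] xmin] := @wo_min _ _ (fun x => embeds T (seg R x)) wf.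
  by exists x0.
pose f t := sval (j t); have fI : injective f by move=> s t /sval_inj /jI.
exists (fun s t => R (f s) (f t)); first exact: wo_pullback fI Rwo.
move=> t Tt; apply: (xmin (f t)); first exact: svalP (j t).
apply: embeds_trans Tt _.
exists (fun s => exist (fun y => R y (f t)) (f (sval s)) (svalP s)) => u v uv.
by apply: sval_inj; apply: fI; case: uv.
Qed.

Lemma succ_card_wo A B : succ_card A B -> infinite A ->
  exists R : B -> B -> Prop, [/\ wo R, forall x, embeds (seg R x) A
    & forall I (f : I -> B), embeds I A -> exists b, forall i, R (f i) b].
Proof.
move=> /succ_cardP[AB BA BC] Ainf; have [R Rwo Rini] := exists_initial_wo B.
have segA x : embeds (seg R x) A by apply: contrapT => /BC; exact: Rini.
by exists R; split=> // I f; exact: bounded_family.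
Qed.

Lemma nth_succ_infinite n A B : nth_succ_card n A B -> infinite A -> infinite B.
Proof.
move=> nB Ainf; elim: n => [|n IH] in B nB *.
  by apply: embeds_trans Ainf _; apply/embedsP; move: nB => /card_eqPle[].
have [C nC /succ_cardP[CB _ _]] := nB.
exact: embeds_trans (IH _ nC) _.
Qed.

Lemma embeds_sig_fun T I (P : T -> Prop) :
  embeds {f : I -> T | forall i, P (f i)} (I -> {x | P x}).
Proof.
exists (fun u i => exist P (sval u i) ((svalP u : forall i, P (sval u i)) i)) => u v uv.
apply: sval_inj; apply/funext => i.
by have := congr1 (fun w => sval (w i)) uv.
Qed.

(** Hausdorff's formula *)
Lemma embeds_fun_nth_succ n A C : infinite A -> nth_succ_card n A C ->
  embeds (set A -> C) (C * set (set A)).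
Proof.
move=> Ainf; set T := set A.
have ATh : embeds A T by exact: embeds_set1.
have Tinf : infinite T by exact: embeds_trans ATh.
have t0 := infinite_inhabited Tinf.
(* For [D] of size at most [T], there are at most [2 ^ T] functions from [T] to [D], so the second
   factor alone suffices. *)
have small D : infinite D -> embeds D T -> embeds (T -> D) (D * set T).
  move=> /infinite_inhabited d0 DT; apply: (@embeds_trans (set T)); last first.
    by exists (fun X => (d0, X)) => X Y [].
  apply: embeds_trans (embeds_fun (B := D) (C := set A) _ DT) _.
  apply: embeds_trans (@embeds_curry T A Prop) _.
  exact: embeds_set (embeds_prod_id Tinf (embeds_refl T) ATh).
elim: n C => [|n IH] C nC.
  apply: small; first exact: nth_succ_infinite nC _.
  by apply: embeds_trans ATh; apply/embedsP; move: nC => /card_eqPle[].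
have Cinf := nth_succ_infinite nC Ainf.
have [C' nC' sC] := nC; have [C'C CC' Cmin] := succ_cardP sC.
have C'inf := nth_succ_infinite nC' Ainf.
have [|CT] := pselect (embeds C T); first exact: small.
have TC' : embeds T C' by apply: contrapT => /Cmin.
have [R [Rwo segC' Rbd]] := succ_card_wo sC C'inf.
(* As [T] embeds in [C'] and [C] is its successor, every function from [T] to [C] is bounded.
   Functions are sorted by a bound [b], and those below [b] are counted by induction, since
   [seg R b] embeds in [C']. *)
apply: (@embeds_trans (C * (C' * set T))).
  apply: (embeds_cover (P := fun b (f : T -> C) => forall i, R (f i) b)).
    by move=> f; exact: Rbd.
  move=> b; apply: embeds_trans (IH _ nC').
  apply: embeds_trans (embeds_fun T (segC' b)).
  exact: embeds_sig_fun.
apply: (@embeds_trans ((C * C') * set T)).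
  by exists (fun p => ((p.1, p.2.1), p.2.2)) => -[a [b c]] [a' [b' c']] [-> -> ->].
apply: embeds_prod (embeds_refl _).
exact: embeds_prod_id Cinf (embeds_refl C) C'C.
Qed.

(** * Enumerations and independent functions *)

Lemma embeds_enum T C (P : set T) (t0 : T) :
  embeds {t | P t} C -> exists g : C -> T, forall t, P t -> exists c, g c = t.
Proof.
move=> [e eI].
exists (fun c => if pselect (exists u, e u = c) is left h then sval (sval (cid h)) else t0).
move=> t Pt; exists (e (exist _ t Pt)); case: pselect => [h|[]]; last by eexists.
by case: cid => u /= /eI ->.
Qed.

(** The Engelking-Karlowicz theorem. An index consists of points [D] separating
    [Theta] many elements of [set (set Theta)], the traces [q] of these elements
    on [D], and the values [r] they should get. *)
Lemma independent_functions Theta A Col :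
  Theta -> Col -> embeds A (set (set Theta)) ->
  exists f : ((Theta -> Theta -> set Theta) * (Theta -> set (Theta * Theta)) *
              (Theta -> Col)) -> A -> Col,
    forall (u : Theta -> A) (e : A -> Col), exists k, forall i, f k (u i) = e (u i).
Proof.
move=> t0 c0 [phi phiI].
pose tr (D : Theta -> Theta -> set Theta) a : set (Theta * Theta) :=
  [set p | phi a (D p.1 p.2)].
exists (fun k a => let: (D, q, r) := k in
  if pselect (exists i, q i = tr D a) is left h then r (sval (cid h)) else c0).
move=> u e.
have [D Dsep] : exists D : Theta -> Theta -> set Theta, forall i j,
    (phi (u i) (D i j) <-> phi (u j) (D i j)) -> u i = u j.
  have [D DP] : {D : Theta * Theta -> set Theta & forall p : Theta * Theta,
      (phi (u p.1) (D p) <-> phi (u p.2) (D p)) -> u p.1 = u p.2}.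
    apply: (@choice _ _ (fun p X =>
      (phi (u p.1) X <-> phi (u p.2) X) -> u p.1 = u p.2)) => p.
    (* If no set worked, none would separate the two points, so they would be equal; but then any
       set works. *)
    apply: contrapT => /forallNP h.
    have upp : u p.1 = u p.2.
      apply: phiI; apply/funext => X; apply/propext.
      by apply: contrapT => nX; apply: (h X).
    by apply: (h set0).
  by exists (fun i j => D (i, j)) => i j; exact: (DP (i, j)).
exists (D, fun i => tr D (u i), fun i => e (u i)) => i /=.
case: pselect => [h|[]]; last by exists i.
case: cid => j /= trE; congr e; apply: Dsep.
by have /seteqP[h1 h2] := trE; split; [exact: (h1 (j, i))|exact: (h2 (j, i))].
Qed.

(** * Order types, ladders and cofinality omega *)

Lemma lt_wo d (K : orderType d) :
  well_founded (fun x y : K => (x < y)%O) -> wo (fun x y : K => (x < y)%O).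
Proof.
move=> wf; split=> // [x y z|x y]; first exact: lt_trans.
by have [xy|yx|->] := ltgtP x y; [right; left|right; right|left].
Qed.

Lemma wf_ltn : well_founded (fun m n : nat => (m < n)%N).
Proof. by move=> n; elim/ltn_ind: n => n IH; constructor. Qed.

(** Recursively, [f x] is the least element of [A] above all earlier values; minimality makes the
    range an initial segment of [A]. *)
Lemma otp_le_unbounded d (K : orderType d) d' (W : orderType d') (A : set K) :
  well_founded (fun x y : K => (x < y)%O) ->
  well_founded (fun x y : W => (x < y)%O) -> K ->
  (forall (x : W) (f : W -> K), (forall y, (y < x)%O -> A (f y)) ->
    exists2 a, A a & forall y, (y < x)%O -> (f y < a)%O) ->
  otp_le [set: W] A.
Proof.
move=> wfK wfW a0 unb.
pose P (x : W) (f : W -> K) (a : K) := [/\ A a, forall y, (y < x)%O -> (f y < a)%O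
  & forall b, A b -> (forall y, (y < x)%O -> (f y < b)%O) -> (a <= b)%O].
have [|f fP] := @rec_choice W K _ P wfW a0.
  move=> x f g a fg [Aa lta mina]; split=> //.
    by move=> y yx; rewrite -fg//; exact: lta.
  by move=> b Ab ltb; apply: mina => // y yx; rewrite fg//; exact: ltb.
have {}fP x : P x f (f x).
  elim/(well_founded_ind wfW): x => x IH; apply: fP.
  have [|a Aa lta] := unb x f; first by move=> y /IH[].
  have [|b [Ab ltb] bmin] := @wo_min _ _
      (fun b => A b /\ forall y, (y < x)%O -> (f y < b)%O) wfK; first by exists a.
  exists b; split=> // c Ac ltc; rewrite leNgt; apply/negP => cb.
  exact: (bmin c).
have Af x : f x \in A by rewrite inE; case: (fP x).
have ltf x y : (y < x)%O -> (f y < f x)%O by case: (fP x) => _ + _; apply.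
have ltfE x y : (f x < f y)%O = (x < y)%O.
  have [xy|yx|->] := ltgtP x y; first exact: ltf.
    by apply/negbTE; rewrite -leNgt ltW//; exact: ltf.
  by rewrite ltxx.
exists (fun x => SigSub (Af (val x))); split=> [x y|x b /= bx]; first exact: ltfE.
(* The first [y] with [b <= f y] satisfies [f y = b]: all earlier values lie below [b], so
   minimality of [f y] gives [f y <= b]. *)
have [|y [by_ _] ymin] := @wo_min _ _ (fun y => (val b <= f y)%O /\ True) wfW.
  by exists (val x); split=> //; exact: ltW.
exists (SigSub (mem_setT y)); apply: val_inj => /=; apply/eqP.
rewrite eq_le by_ andbT; case: (fP y) => _ _; apply; first exact: set_valP.
by move=> z /ymin nz; rewrite ltNge; apply/negP => bz; apply: nz.
Qed.

Definition ladder d (K : orderType d) (delta : K) (s : nat -> K) : Prop :=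
  [/\ forall i, (s i < s i.+1)%O, forall i, (s i < delta)%O
    & forall x, (x < delta)%O -> exists i, (x <= s i)%O].

Section LadderOrd.
Context d (K : orderType d).
Implicit Types (s : nat -> K) (delta : K).

Lemma increasing_lt s : (forall i, (s i < s i.+1)%O) ->
  forall i j, (s i < s j)%O = (i < j)%N.
Proof.
move=> s_incr.
have lts i j : (i < j)%N -> (s i < s j)%O.
  elim: j => // j IH; rewrite ltnS leq_eqVlt => /orP[/eqP->//|/IH ij].
  exact: lt_trans (s_incr j).
move=> i j; have [ij|ji|->] := ltngtP i j; first exact: lts.
  by apply/negbTE; rewrite -leNgt ltW//; exact: lts.
by rewrite ltxx.
Qed.

Lemma increasing_le s : (forall i, (s i < s i.+1)%O) ->
  forall i j, (s i <= s j)%O = (i <= j)%N.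
Proof. by move=> s_incr i j; rewrite leNgt increasing_lt// -leqNgt. Qed.

Lemma ladder_unique s delta delta' : ladder delta s -> ladder delta' s -> delta = delta'.
Proof.
have le e e' : ladder e s -> ladder e' s -> (e <= e')%O.
  move=> [_ _ cof] [_ lt _]; rewrite leNgt; apply/negP => /cof[i].
  by rewrite leNgt lt.
by move=> L L'; apply/le_anti; rewrite !le.
Qed.

Lemma ladder_cofinal delta s : ladder delta s -> cofinal_in (below delta) (range s).
Proof.
move=> [s_incr s_lt s_cof]; split=> [_ [i _ <-]|x /s_cof[i xi]]; first exact: s_lt.
by exists (s i) => //; exists i.
Qed.

Lemma ladder_otp delta s : ladder delta s -> otp_eq (range s) [set: nat].
Proof.
move=> [s_incr _ _].
have sI : injective s.
  move=> i j sij; apply/eqP; rewrite eqn_leq -!(increasing_le s_incr) sij.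
  by rewrite lexx.
have ix (x : range s) : {i | s i = val x}.
  by apply: cid; have [i _ <-] := set_valP x; exists i.
exists (fun x => SigSub (mem_setT (sval (ix x)))); split=> [x y|i] /=.
  by case: (ix x) (ix y) => [i ix_] [j jy] /=; rewrite -[in RHS]ix_ -jy increasing_lt.
have sr : s (val i) \in range s by rewrite inE; exists (val i).
exists (SigSub sr); apply: val_inj => /=; case: (ix _) => j /=; exact: sI.
Qed.

Lemma otp_eq_le d' (W : orderType d') (A : set K) (B : set W) :
  otp_eq A B -> otp_le A B.
Proof. by move=> [f [fE fO]]; exists f; split=> // x b _; exact: fO. Qed.

(** The range of [s] is cofinal of type omega. Any other cofinal set has elements above each finite
    set of its elements, because [delta] is a limit, so omega embeds in it as an initial segment. *)
Lemma ladder_E_omega delta s :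
  well_founded (fun x y : K => (x < y)%O) -> ladder delta s -> E_omega K delta.
Proof.
move=> wf sL; split; first by exists (range s); [exact: ladder_cofinal|exact: ladder_otp sL].
move=> A [Adelta Acof]; have [s_incr s_lt s_cof] := sL.
apply: (otp_le_unbounded wf wf_ltn delta).
move=> x f; elim: x => [|n IH] fA.
  by have [a Aa _] := Acof _ (s_lt 0); exists a.
have [|a Aa lta] := IH; first by move=> y yn; apply: fA; exact: ltn_trans yn _.
have [|i mi] := s_cof (Order.max a (f n)).
  rewrite gt_max; apply/andP; split; first exact: Adelta.
  by apply: Adelta; apply: fA; exact: ltnSn.
have [b Ab sb] := Acof _ (s_lt i.+1); exists b => // y.
have mb : (Order.max a (f n) < b)%O.
  by apply: lt_le_trans sb; apply: le_lt_trans mi _.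
move: mb; rewrite gt_max => /andP[ab fb].
rewrite ltEnat /= ltnS leq_eqVlt => /orP[/eqP->//|yn].
by apply: lt_trans ab; exact: lta.
Qed.

Lemma E_omega_ladder delta : E_omega K delta -> exists s, ladder delta s.
Proof.
move=> [[A [Adelta Acof] [f [fE fO]]] _].
have [a aE] : {a : nat -> A & forall n, val (f (a n)) = n}.
  apply: (@choice _ _ (fun n a => val (f a) = n)) => n.
  by have [a fa] := fO (SigSub (mem_setT n)); exists a; rewrite fa.
exists (fun n => val (a n)); split=> [i|i|x /Acof[b Ab xb]].
- by rewrite -fE !aE ltEnat /= ltnSn.
- exact/Adelta/set_valP.
- have Ab' : b \in A by rewrite inE.
  exists (val (f (SigSub Ab'))); apply: le_trans xb _.
  by rewrite leNgt -[b]/(val (SigSub Ab')) -fE aE ltxx.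
Qed.

End LadderOrd.

(** * Regularity of the successor of [chi] and stationarity of [E_omega] *)

Section Regular.
Context d (K : orderType d) (chi : Type).
Hypothesis wfK : well_founded (fun x y : K => (x < y)%O).
Hypothesis chi_inf : infinite chi.
Hypothesis seg_chi : forall x : K, embeds {y | (y < x)%O} chi.
Hypothesis K_chi : ~ embeds K chi.

Lemma bounded_K I (f : I -> K) : embeds I chi -> exists b, forall i, (f i < b)%O.
Proof. exact: bounded_family (lt_wo wfK) seg_chi chi_inf K_chi. Qed.

Lemma bounded_below x (f : K -> K) : exists b, forall y, (y < x)%O -> (f y < b)%O.
Proof.
have [b bP] := bounded_K (fun u : {y | (y < x)%O} => f (sval u)) (seg_chi x).
by exists b => y yx; exact: (bP (exist _ y yx)).
Qed.

Lemma K_no_max x : exists y : K, (x < y)%O.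
Proof.
have [b bP] := bounded_K (fun _ : nat => x) chi_inf.
by exists b; exact: (bP 0).
Qed.

Lemma increasing_ladder (s : nat -> K) :
  (forall i, (s i < s i.+1)%O) -> exists delta, ladder delta s.
Proof.
move=> s_incr; have [b bP] := bounded_K s chi_inf.
have [|delta dP dmin] := @wo_min _ _ (fun b => forall i, (s i < b)%O) wfK.
  by exists b.
exists delta; split=> // x /dmin nx; apply: contrapT => /forallNP h.
by apply: nx => i; rewrite ltNge; apply/negP/h.
Qed.

Lemma K_cf : K -> cf [set: K] [set: K].
Proof.
move=> k0; split.
  exists setT; first by split=> // x _; exists x.
  by exists id; split=> // b; exists b.
move=> A [_ Acof]; apply: (otp_le_unbounded wfK wfK k0) => x f _.
have [b bP] := bounded_below x f; have [a Aa ba] := Acof b I.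
by exists a => // y yx; apply: lt_le_trans ba; exact: bP.
Qed.

Lemma E_omega_stationary : K -> stationary (E_omega K).
Proof.
move=> k0 C [[_ Ccof] Cclosed].
have next x : exists y, C y /\ (x < y)%O.
  have [y xy] := K_no_max x; have [c Cc yc] := Ccof y I.
  by exists c; split=> //; exact: lt_le_trans yc.
have [g gP] := choice next.
(* The start at the first iterate puts every term in [C], to which [k0] need not belong. *)
pose s i := iter i.+1 g k0.
have s_incr i : (s i < s i.+1)%O by case: (gP (s i)).
have sC i : C (s i) by case: (gP (iter i g k0)).
have [delta sL] := increasing_ladder s_incr; exists delta; split.
  exact: ladder_E_omega sL.
have [_ s_lt s_cof] := sL.
apply: Cclosed => [|y /s_cof[i yi]]; first by exists (s 0).
by exists (s i.+1) => //; apply/andP; split; [exact: le_lt_trans (s_incr i)|].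
Qed.

(** * Sparse sets and capturing families of sequences *)

Definition sparse (G : K -> K) (X : set K) : Prop :=
  forall x x', X x -> X x' -> (x < x')%O -> forall y, (y <= x)%O -> (G y < x')%O.

Lemma sparse_sequence (G : K -> K) : K ->
  exists2 s : K -> K, injective s & sparse G (range s).
Proof.
move=> k0.
have [|s sP] := @rec_choice K K _ (fun x s u => forall y, (y < x)%O ->
    (s y < u)%O /\ forall w, (w <= s y)%O -> (G w < u)%O) wfK k0.
  by move=> x f g u fg h y yx; rewrite -fg//; exact: h.
have {}sP x : forall y, (y < x)%O ->
    (s y < s x)%O /\ forall w, (w <= s y)%O -> (G w < s x)%O.
  apply: sP.
  (* [b v] bounds [G] on the closed segment at [v]; the next term has to exceed all [s y] and
     [b (s y)], which is possible by regularity. *)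
  have [b bP] : {b : K -> K & forall v w, (w <= v)%O -> (G w < b v)%O}.
    apply: (@choice _ _ (fun v b => forall w, (w <= v)%O -> (G w < b)%O)) => v.
    have [v' vv'] := K_no_max v; have [b bP] := bounded_below v' G.
    by exists b => w wv; apply: bP; exact: le_lt_trans vv'.
  have [u uP] := bounded_below x (fun y => Order.max (s y) (b (s y))).
  exists u => y /uP; rewrite gt_max => /andP[su bu]; split=> // w wsy.
  exact: lt_trans (bP _ _ wsy) bu.
have s_lt x y : (y < x)%O -> (s y < s x)%O by case/sP.
have sE x y : (s y < s x)%O = (y < x)%O.
  have [yx|xy|->] := ltgtP y x; first exact: s_lt.
    by apply/negbTE; rewrite -leNgt ltW//; exact: s_lt.
  by rewrite ltxx.
exists s.
  move=> x y sxy; have [xy|yx|//] := ltgtP x y.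
    by have := s_lt _ _ xy; rewrite sxy ltxx.
  by have := s_lt _ _ yx; rewrite sxy ltxx.
move=> _ _ [x _ <-] [x' _ <-]; rewrite sE => /sP[_ h] w; exact: h.
Qed.

Lemma sparse_subset (G : K -> K) (X Y : set K) : X `<=` Y -> sparse G Y -> sparse G X.
Proof. by move=> XY spY x x' /XY Yx /XY; exact: spY. Qed.

Lemma sparse_le (G H : K -> K) (X : set K) :
  (forall x, (G x <= H x)%O) -> sparse H X -> sparse G X.
Proof.
move=> GH spH x x' Xx Xx' xx' y yx.
by apply: le_lt_trans (GH y) _; exact: spH Xx Xx' xx' _ yx.
Qed.

(** This is the purpose of sparseness: [y <= s i] gives [G y < s i.+1], which is below [delta]. *)
Lemma sparse_ladder_closed (G : K -> K) (X : set K) delta s :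
  sparse G X -> ladder delta s -> (forall i, X (s i)) ->
  forall y, (y < delta)%O -> (G y < delta)%O.
Proof.
move=> spX [s_incr s_lt s_cof] sX y /s_cof[i yi].
by apply: lt_trans (s_lt i.+1); exact: spX (sX i) (sX i.+1) (s_incr i) _ yi.
Qed.

(** The guessing property to be pushed down from [chi] to [T] many sequences at each point.
    Sequences in the sparse set are given by their indices [t], so that there are only [Theta] many
    of them. *)
Definition capturing (Theta C : Type) (a : K -> C -> nat -> K) : Prop :=
  forall G : K -> K, exists X : Theta -> K, [/\ injective X, sparse G (range X)
    & forall (t : nat -> Theta) delta, ladder delta (X \o t) ->
      exists c, a delta c = X \o t].

Variable Theta : Type.
Hypothesis Theta_nat : embeds (nat -> Theta) Theta.
Hypothesis ThetaK : embeds Theta K.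

(** There are at most [chi] many sequences below [delta], so [a delta] can list them all. *)
Lemma capturing_base : K -> embeds (nat -> chi) chi ->
  exists a : K -> chi -> nat -> K, capturing Theta a.
Proof.
move=> k0 chi_nat.
have [a aP] : {a : K -> chi -> nat -> K & forall delta s,
    (forall i, (s i < delta)%O) -> exists c, a delta c = s}.
  apply: (@choice _ _ (fun delta a => forall s,
    (forall i, (s i < delta)%O) -> exists c, a c = s)) => delta.
  apply: embeds_enum (fun=> k0) _.
  apply: embeds_trans (embeds_sig_fun nat (fun y => (y < delta)%O)) _.
  apply: embeds_trans chi_nat; exact: embeds_fun (seg_chi delta).
exists a => G; have [s sI sparse_s] := sparse_sequence G k0.
have [j jI] := ThetaK; exists (s \o j); split; first exact: inj_comp.
  by apply: sparse_subset sparse_s => _ [x _ <-]; exists (j x).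
by move=> t delta [_ h _]; exact: aP.
Qed.

Lemma capturing_onto C C' (g : C' -> C) (a : K -> C -> nat -> K) :
  (forall c, exists c', g c' = c) -> capturing Theta a ->
  capturing Theta (fun delta => a delta \o g).
Proof.
move=> gO aP G; have [X [XI spX Xa]] := aP G; exists X; split=> // t delta.
by move=> /Xa[c <-]; have [c' <-] := gO c; exists c'.
Qed.

(** Otherwise each of the proper initial segments of [C] fails for some [G c];
    a set sparse for all of them has at most [Theta] many sequences, hence the
    segments needed to capture these are bounded in [C]. *)
Lemma capturing_pred C C' (a : K -> C -> nat -> K) : succ_card C' C ->
  infinite C' -> embeds Theta C' -> embeds C chi -> capturing Theta a ->
  exists a' : K -> C' -> nat -> K, capturing Theta a'.
Proof.
move=> sC C'inf TC' Cchi aP; have [R [Rwo segC' Rbd]] := succ_card_wo sC C'inf.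
have c0 : C by case: (succ_cardP sC) => /cid[f _] _ _; exact: f (infinite_inhabited C'inf).
have [e eP] : {e : C -> C' -> C & forall b c, R c b -> exists c', e b c' = c}.
  apply: (@choice _ _ (fun b e => forall c, R c b -> exists c', e c' = c)) => b.
  exact: embeds_enum c0 (segC' b).
apply: contrapT => /forallNP na.
have [G GP] : {G : C -> K -> K & forall b, ~ exists X : Theta -> K,
    [/\ injective X, sparse (G b) (range X) & forall t delta,
      ladder delta (X \o t) -> exists c, a delta (e b c) = X \o t]}.
  apply: (@choice _ _ (fun b G => ~ exists X : Theta -> K,
    [/\ injective X, sparse G (range X) & forall t delta,
      ladder delta (X \o t) -> exists c, a delta (e b c) = X \o t])) => b.
  by have /existsNP[G nG] := na (fun delta => a delta \o e b); exists G.
(* Only [C], hence at most [chi], many functions [G b] have to be dominated. *)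
have [H HP] : {H : K -> K & forall x b, (G b x < H x)%O}.
  apply: (@choice _ _ (fun x h => forall b, (G b x < h)%O)) => x.
  exact: bounded_K Cchi.
have [X [XI spX Xa]] := aP H.
(* A sequence determines its limit, so its index in [C] depends on [t] alone. The indices used
   number at most [C'] and are bounded by some [b], which contradicts the choice of [G b]. *)
have [c cP] : {c : (nat -> Theta) -> C & forall t delta,
    ladder delta (X \o t) -> a delta (c t) = X \o t}.
  apply: (@choice _ _ (fun t c => forall delta,
    ladder delta (X \o t) -> a delta c = X \o t)) => t.
  have [[delta dL]|nL] := pselect (exists delta, ladder delta (X \o t)).
    have [c ac] := Xa _ _ dL; exists c => delta' dL'.
    by rewrite (ladder_unique dL' dL).
  by exists c0 => delta dL; case: nL; exists delta.
have [b bP] := Rbd _ c (embeds_trans Theta_nat TC').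
apply: (GP b); exists X; split=> //.
  by apply: sparse_le spX => x; exact/ltW/HP.
move=> t delta /cP act; have [c' ec'] := eP _ _ (bP t); exists c'.
by rewrite ec'.
Qed.

End Regular.

(** Descent through predecessors, stopping once the index type embeds in [set A]. Until then the
    predecessor still has at least [set A] many elements, as the descent step requires. *)
Lemma capturing_nth_succ d (K : orderType d) chi n A C (a : K -> C -> nat -> K) :
  well_founded (fun x y : K => (x < y)%O) -> infinite chi ->
  (forall x : K, embeds {y | (y < x)%O} chi) -> ~ embeds K chi ->
  infinite A -> embeds (nat -> set A) (set A) -> nth_succ_card n A C ->
  embeds C chi -> capturing (set A) a ->
  exists a' : K -> set A -> nat -> K, capturing (set A) a'.
Proof.
move=> wfK chi_inf seg_chi K_chi Ainf nat_A.
have small D (b : K -> D -> nat -> K) : infinite D -> embeds D (set A) -> capturing (set A) b ->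
    exists a' : K -> set A -> nat -> K, capturing (set A) a'.
  move=> /infinite_inhabited d0 /(embeds_ontoP d0)[g gO] /(capturing_onto gO) bP.
  by eexists; exact: bP.
elim: n C a => [|n IH] C a nC Cchi aP.
  apply: small aP; first exact: nth_succ_infinite nC Ainf.
  apply: embeds_trans (embeds_set1 A).
  by apply/embedsP; move: nC => /card_eqPle[].
have [|CA] := pselect (embeds C (set A)).
  by move=> CA; apply: small aP => //; exact: nth_succ_infinite nC Ainf.
have [C' nC' sC] := nC; have [C'C _ Cmin] := succ_cardP sC.
have AC' : embeds (set A) C' by apply: contrapT => /Cmin.
have [a' a'P] := capturing_pred wfK chi_inf seg_chi K_chi nat_A sC
  (nth_succ_infinite nC' Ainf) AC' Cchi aP.
by apply: IH a'P => //; exact: embeds_trans Cchi.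
Qed.

(** * Uniformization from metacompactness, and increasing subsequences *)

Lemma metacompact_uniform d (K : orderType d) (S : set K) (L : S -> set K) :
  countably_metacompact (ladder_space L) ->
  forall f : S -> nat, exists g : K -> nat, forall delta : S,
    exists2 B, end_segment (L delta) B & forall x, B x -> (f delta <= g x)%N.
Proof.
move=> mc f.
(* Every set of points [(delta, 1)] is closed, so these sets qualify. A point [x] of [K] leaves the
   open expansions at some stage, taken as [g x]; an end segment of [L delta] lies in [U (f delta)],
   where [g] exceeds [f delta]. *)
pose D n : set (ladder_space L) :=
  [set p | if p is inr delta then (n <= f delta)%N else False].
have [||| U [Uo Udecr U0 DU]] := mc D.
- move=> n; rewrite -openC openE => -[alpha|delta] np; first by move=> [].

  exists (L delta); first exact: end_segment_refl.
  by move=> _ [[x _ <-]|->].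
- by move=> n [//|delta]; exact: ltnW.
- apply/seteqP; split=> // -[alpha|delta] h; first exact: (h 0).
  by have := h (f delta).+1 I; rewrite /D /= ltnn.
have Ule m n : (m <= n)%N -> U n `<=` U m.
  by elim: n => [|n IH]; [rewrite leqn0 => /eqP->|
    rewrite leq_eqVlt => /orP[/eqP->//|/IH nm] p /Udecr /nm].
have [g gP] : {g : K -> nat & forall x, ~ U (g x) (inl x)}.
  apply: (@choice _ _ (fun x n => ~ U n (inl x))) => x; apply/existsNP => Ux.
  by have : (\bigcap_n U n) (inl x) by []; rewrite U0.
exists g => delta; have Ud : U (f delta) (inr delta) by apply: DU; rewrite /D /=.
have [B LB BU] : nbhs (inr delta : ladder_space L) (U (f delta)).
  by have := Uo (f delta); rewrite openE => /(_ _ Ud).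
exists B => // x Bx; rewrite leqNgt; apply/negP => /ltnW /Ule Ugx.
by apply: (gP x); apply: Ugx; apply: BU; left; exists x.
Qed.

Lemma infinite_increasing d (K : orderType d) I (X : I -> K) (Y : set I) :
  well_founded (fun x y : K => (x < y)%O) -> injective X -> infinite_set Y ->
  exists t : nat -> I, forall m, Y (t m) /\ (X (t m) < X (t m.+1))%O.
Proof.
move=> wfK XI Yinf.
have [i0 _] := cid (infinite_setN0 Yinf).
pose P m (t : nat -> I) i := [/\ Y i, forall j, (j < m)%N -> t j <> i
  & forall i', Y i' -> (forall j, (j < m)%N -> t j <> i') -> (X i <= X i')%O].
have [|t tP] := @rec_choice nat I _ P wf_ltn i0.
  move=> m t t' i tt' [Yi ti imin]; split=> // [j jm|i' Yi' ti'].
    by rewrite -tt'//; exact: ti.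
  by apply: imin => // j jm; rewrite tt'//; exact: ti'.
have {}tP m : P m t (t m).
  apply: tP; have [|x [i [Yi ti] <-] xmin] := @wo_min _ _ (fun x =>
      exists2 i, (Y i /\ forall j, (j < m)%N -> t j <> i) & X i = x) wfK.
    apply: contrapT => nx; apply: Yinf.
    apply: sub_finite_set (finite_image t (finite_II m)) => i Yi.
    apply: contrapT => ni; apply: nx; exists (X i), i => //; split=> // j jm ij.
    by apply: ni; exists j.
  exists i; split=> // i' Yi' ti'; rewrite leNgt; apply/negP => /xmin; apply.
  by exists i'.
exists t => m; have [Yt _ tmin] := tP m; have [Yt' tm' _] := tP m.+1; split=> //.
rewrite lt_neqAle; apply/andP; split.
  by apply/eqP => /XI; exact: tm'.
by apply: tmin => // j jm; apply: tm'; exact: ltnW.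
Qed.

(** * Failure of countable metacompactness on [E_omega] *)

Section Main.
Context (A : Type) (d : Order.disp_t) (K : orderType d) (chi : Type) (n : nat).
Hypothesis Ainf : infinite A.
Hypothesis Kini : initial_ordinal K.
Hypothesis KA : embeds K (set (set (set A))).
Hypothesis AK : embeds (set (set (set A))) K.
Hypothesis chiA : nth_succ_card n A chi.
Hypothesis chiK : succ_card chi K.

Let T := set A.
Let Col := (T * nat)%type.

Let wfK : well_founded (fun x y : K => (x < y)%O). Proof. by case: Kini. Qed.
Let chi_inf : infinite chi. Proof. exact: nth_succ_infinite chiA Ainf. Qed.
Let K_chi : ~ embeds K chi. Proof. by case: (succ_cardP chiK). Qed.

Let chi_max C : ~ embeds K C -> embeds C chi.
Proof. by have [_ _ h] := succ_cardP chiK => KC; apply: contrapT => /h. Qed.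

Let Tinf : infinite T. Proof. exact: embeds_trans (embeds_set1 A). Qed.
Let sTinf : infinite (set T). Proof. exact: embeds_trans (embeds_set1 T). Qed.

Let K_sT : ~ embeds K (set T).
Proof. by move=> /(embeds_trans AK); exact: not_embeds_set. Qed.

Let K_inf : infinite K.
Proof. by apply: embeds_trans AK; apply: embeds_trans (embeds_set1 _). Qed.

Let T_chi : embeds T chi.
Proof. by apply: chi_max => KT; apply: K_sT; apply: embeds_trans (embeds_set1 _). Qed.

Let T_K : embeds T K.
Proof. by apply: embeds_trans T_chi _; case: (succ_cardP chiK). Qed.

Let seg_chi (x : K) : embeds {y | (y < x)%O} chi.
Proof.
apply: chi_max => Kx; have [_ /(_ x)[_]] := Kini; apply.
apply/embeds_setP; apply: embeds_trans Kx.
exact: embeds_sig.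
Qed.

Let fun_chi : embeds (T -> chi) chi.
Proof.
apply: chi_max => K_fun.
(* By Hausdorff's formula [K] would have size at most the maximum of [chi] and [2 ^ T], and both are
   smaller than [K]. *)
have := embeds_trans K_fun (embeds_fun_nth_succ Ainf chiA).
have [chi_sT|sT_chi] := embeds_total chi (set T) => K_prod.
  apply: K_sT; apply: embeds_trans K_prod _.
  exact: embeds_prod_id sTinf chi_sT (embeds_refl _).
apply: K_chi; apply: embeds_trans K_prod _.
exact: embeds_prod_id chi_inf (embeds_refl _) sT_chi.
Qed.

Let fun_set I J C : infinite C -> embeds I C -> embeds J C -> embeds (I -> set J) (set C).
Proof.
move=> Cinf IC JC; apply: embeds_trans (@embeds_curry I J Prop) _.
exact: embeds_set (embeds_prod_id Cinf IC JC).
Qed.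

Let nat_T : embeds (nat -> T) T.
Proof. exact: fun_set Ainf Ainf (embeds_refl A). Qed.

Let nat_chi : embeds (nat -> chi) chi.
Proof. by apply: embeds_trans fun_chi; apply: embeds_dom Tinf; exact: 0. Qed.

Let Col_T : embeds Col T.
Proof. exact: embeds_prod_id Tinf (embeds_refl T) Tinf. Qed.

Let Eps := ((T -> T -> set T) * (T -> set (T * T)) * (T -> Col))%type.

Let t0 : T := set0.
Let eps0 : Eps := (fun _ _ => set0, fun=> set0, fun=> (t0, 0)).

Let Eps_K : embeds (Eps -> nat) K.
Proof.
have TT : embeds (T * T) T by exact: infinite_square.
(* Each of the three components of [Eps] has at most [2 ^ T] values, so [Eps -> nat] has at most
   [2 ^ (2 ^ T)] elements, the size of [K]. *)
apply: (@embeds_trans (set T -> nat)).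
  apply: embeds_dom eps0 _; apply: embeds_prod_id sTinf _ _; last first.
    apply: embeds_trans (embeds_fun T Col_T) _.
    exact: fun_set Tinf (embeds_refl T) (embeds_set1 A).
  apply: embeds_prod_id sTinf _ _; last exact: fun_set Tinf (embeds_refl T) TT.
  apply: embeds_trans (embeds_curry T T (set T)) _.
  exact: fun_set Tinf TT (embeds_refl T).
apply: embeds_trans (embeds_fun (set T) sTinf) _; apply: embeds_trans AK.
exact: fun_set sTinf (embeds_refl _) (embeds_set1 T).
Qed.

Let k0 : K. Proof. exact: infinite_inhabited K_inf. Qed.

Let captures : exists a : K -> T -> nat -> K,
  (forall delta c, E_omega K delta -> ladder delta (a delta c)) /\ capturing T a.
Proof.
have [b bP] := capturing_base wfK chi_inf seg_chi K_chi T_K k0 nat_chi.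
have [a aP] := capturing_nth_succ wfK chi_inf seg_chi K_chi Ainf nat_T chiA
  (embeds_refl chi) bP.
have [l lP] : {l : K -> nat -> K & forall delta, E_omega K delta -> ladder delta (l delta)}.
  apply: (@choice _ _ (fun delta l => E_omega K delta -> ladder delta l)) => delta.
  have [/E_omega_ladder[s sL]|nE] := pselect (E_omega K delta); first by exists s.
  by exists (fun=> delta).
(* Sequences that are not ladders at [delta] are replaced by the fixed ladder [l delta]. Nothing is
   lost, as only ladders have to be captured. *)
exists (fun delta c => if pselect (ladder delta (a delta c)) is left _
                       then a delta c else l delta); split=> [delta c Ed|G].
  by case: pselect => // _; exact: lP.
have [X [XI spX Xa]] := aP G; exists X; split=> // t delta tL.
by have [c ac] := Xa t delta tL; exists c; case: pselect => //; rewrite ac.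
Qed.

Lemma E_omega_carries : E_omega_carries_non_metacompact K.
Proof.
apply: contrapT => ncarry.
have [a [aL aP]] := captures.
have [f fP] := @independent_functions T (K * K) Col t0 (t0, 0)
  (embeds_trans (infinite_square K_inf) KA).
have [dec decP] := embeds_ontoP (fun=> 0) Eps_K.
(* [p] is a possible trace of [G] on the sequences at [delta], and [dec] turns its values into
   functions of [k]. The condition is that [nu] survives the uniformization inequality for every
   [k]. *)
pose bad delta (p : Col -> K) nu := forall k, exists N, forall i, (N <= i)%N ->
  ((f k (delta, nu)).2 <= dec (p ((f k (delta, nu)).1, i)) k)%N.
have [h hP] : {h : K -> K & forall delta p, (forall u, (p u < delta)%O) ->
    bad delta p (h delta) -> embeds Col {nu | bad delta p nu}}.
  apply: (@choice _ _ (fun delta nu => forall p, (forall u, (p u < delta)%O) ->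
    bad delta p nu -> embeds Col {nu | bad delta p nu})) => delta.
  apply: contrapT => /forallNP nh; apply: K_chi.
  (* Otherwise each [nu] survives some [p] that has at most [T] many survivors. There are only [chi]
     many such [p], so [K] would embed in [chi]. *)
  pose P := {p : Col -> K | (forall u, (p u < delta)%O) /\
                            ~ embeds Col {nu | bad delta p nu}}.
  have P_chi : embeds P chi.
    apply: (@embeds_trans {p : Col -> K | forall u, (p u < delta)%O}).
      by apply: embeds_sub => p [].
    apply: embeds_trans (embeds_sig_fun Col (fun y => (y < delta)%O)) _.
    apply: embeds_trans (embeds_fun Col (seg_chi delta)) _.
    by apply: embeds_trans fun_chi; apply: embeds_dom Col_T; exact: (t0, 0).
  apply: embeds_trans (embeds_prod_id chi_inf P_chi T_chi).
  apply: (embeds_cover (P := fun (p : P) nu => bad delta (sval p) nu)) => [nu|p].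
    have /existsNP[p /not_implyP[pd /not_implyP[bp np]]] := nh nu.
    by exists (exist _ p (conj pd np)).
  apply: embeds_trans Col_T.
  by have [_ np] := svalP p; have [] := embeds_total {nu | bad delta (sval p) nu} Col.
pose col k delta := f k (delta, h delta).
have [g gP] : {g : Eps -> K -> nat & forall k delta, E_omega K delta ->
    exists N, forall i, (N <= i)%N ->
      ((col k delta).2 <= g k (a delta (col k delta).1 i))%N}.
  apply: (@choice _ _ (fun k g => forall delta, E_omega K delta ->
    exists N, forall i, (N <= i)%N ->
      ((col k delta).2 <= g (a delta (col k delta).1 i))%N)) => k.
  pose L (delta : E_omega K) := range (a (val delta) (col k (val delta)).1).
  have LL (delta : E_omega K) : ladder (val delta) (a (val delta) (col k (val delta)).1).
    by apply: aL; exact: set_valP.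
  have mc : countably_metacompact (ladder_space L).
    apply: contrapT => nmc; apply: ncarry; exists L; split=> //.
      split; last by move=> delta; exact: ladder_cofinal (LL delta).
        split=> //; first exact: K_cf wfK chi_inf seg_chi K_chi k0.
        move=> /embedsP K_nat; apply: K_chi; exact: embeds_trans chi_inf.
      exact: E_omega_stationary wfK chi_inf seg_chi K_chi k0.
    by move=> delta; apply: otp_eq_le; exact: ladder_otp (LL delta).
  have [g gP] := metacompact_uniform mc (fun delta => (col k (val delta)).2).
  exists g => delta Ed; have Ed' : delta \in E_omega K by rewrite inE.
  have [B [BL B0 Bup] gB] := gP (SigSub Ed'); have := LL (SigSub Ed').
  rewrite /L /= in BL B0 Bup gB * => -[s_incr _ _].
  have [|x Bx] := B0; first by exists (a delta (col k delta).1 0), 0.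
  have [N _ Nx] := BL _ Bx; exists N => i Ni; apply: gB.
  apply: (Bup x) => //; first by exists i.
  by rewrite -Nx (increasing_le s_incr).
have [G GP] : {G : K -> K & forall x k, dec (G x) k = g k x}.
  apply: (@choice _ _ (fun x y => forall k, dec y k = g k x)) => x.
  by have [y yE] := decP (g^~ x); exists y => k; rewrite yE.
have [X [XI spX Xa]] := aP G.
pose p delta (u : Col) := G (a delta u.1 u.2).
(* [delta] is closed under [G], so the actual trace [p delta] stays below [delta]; [h delta]
   survives it by the choice of [g], hence so do [Col] many points. *)
have big t delta : ladder delta (X \o t) -> embeds Col {nu | bad delta (p delta) nu}.
  move=> tL; have Ed := ladder_E_omega wfK tL; apply: (hP delta).
    move=> u; apply: (sparse_ladder_closed spX tL); first by move=> i; exists (t i).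
    by have [_ ad _] := aL delta u.1 Ed.
  by move=> k; have [N NP] := gP k delta Ed; exists N => i /NP; rewrite GP.
have [nu nuP] : {nu : K -> Col -> K & forall delta,
    embeds Col {nu | bad delta (p delta) nu} ->
    injective (nu delta) /\ forall c, bad delta (p delta) (nu delta c)}.
  apply: (@choice _ _ (fun delta nu => embeds Col {nu | bad delta (p delta) nu} ->
    injective nu /\ forall c, bad delta (p delta) (nu c))) => delta.
  have [[e eI]|ne] := pselect (embeds Col {nu | bad delta (p delta) nu}).
    exists (fun c => sval (e c)) => _; split=> [c c' /sval_inj /eI //|c].
    exact: svalP (e c).
  by exists (fun=> k0).
have [lim limP] : {lim : (nat -> T) -> K & forall t delta,
    ladder delta (X \o t) -> lim t = delta}.
  apply: (@choice _ _ (fun t l => forall delta, ladder delta (X \o t) -> l = delta)) => t.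
  have [[delta tL]|nL] := pselect (exists delta, ladder delta (X \o t)).
    by exists delta => delta'; exact: ladder_unique.
  by exists k0 => delta tL; case: nL; exists delta.
have [u uP] : exists u : T -> (nat -> T) * Col, forall tc, exists i, u i = tc.
  apply: embeds_ontoP; first exact: (fun=> t0, (t0, 0)).
  exact: embeds_prod_id Tinf nat_T Col_T.
(* The prescription is the value [c] at the point [(delta, nu delta c)], well defined because
   [nu delta] is injective. *)
have [e eP] : {e : K * K -> Col & forall x c,
    injective (nu x.1) -> nu x.1 c = x.2 -> e x = c}.
  apply: (@choice _ _ (fun x e => forall c, injective (nu x.1) ->
    nu x.1 c = x.2 -> e = c)) => x.
  have [[c cx]|nc] := pselect (exists c, nu x.1 c = x.2).
    by exists c => c' nuI c'x; apply: nuI; rewrite cx.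
  by exists (t0, 0) => c' _ c'x; case: nc; exists c'.
have [k kP] := fP (fun i => (lim (u i).1, nu (lim (u i).1) (u i).2)) e.
(* Were all fibers of [g k] along [X] finite, [T] would be countable. *)
have [n0 Yinf] : exists n0, infinite_set [set i | g k (X i) = n0].
  apply: contrapT => /forallNP fin; apply: (@not_embeds_set A).
  apply: embeds_trans Ainf; apply: embeds_trans (infinite_square (embeds_refl nat)).
  apply: (embeds_cover (P := fun m i => g k (X i) = m)) => [i|m]; first by exists (g k (X i)).
  have /contrapT /finite_set_countable /embeds_setP := fin m.
  by move=> Y_nat; apply: embeds_trans Y_nat (embeds_sig _).
have [t tP] := infinite_increasing wfK XI Yinf.
have [delta tL] : exists delta, ladder delta (X \o t).
  by apply: (increasing_ladder wfK chi_inf seg_chi K_chi) => i; case: (tP i).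
have [c ac] := Xa t delta tL.
have [nuI nu_bad] := nuP delta (big t delta tL).
have [i ui] := uP (t, (c, n0.+1)).
(* For this survivor [g k] must eventually be at least [n0.+1] on [a delta c], where it is
   constantly [n0]. *)
have fk : f k (delta, nu delta (c, n0.+1)) = (c, n0.+1).
  by have := kP i; rewrite ui /= (limP _ _ tL) (eP _ (c, n0.+1)).
have [N] := nu_bad (c, n0.+1) k; rewrite fk /= => /(_ N (leqnn N)).
by rewrite GP ac /=; have [-> _] := tP N; rewrite ltnn.
Qed.

End Main.

(** * Finite successors and the case of aleph_omega *)

Lemma nth_succ_below n A B C : nth_succ_card n A B -> ~ embeds C A ->
  ~ embeds B C -> exists m, nth_succ_card m A C.
Proof.
elim: n B => [|n IH] B /= => [/card_eqPle[_ /embedsP BA] CA BC|].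
  have [//|AC] := embeds_total C A.
  by case: BC; exact: embeds_trans AC.
move=> [D nD sD] CA BC; have [_ _ Dmin] := succ_cardP sD.
have CD : embeds C D by apply: contrapT => /Dmin.
(* [C] embeds in the predecessor [D] of [B]: either it is equipotent with [D], or it is smaller and
   the induction applies. *)
have [DC|] := pselect (embeds D C); last exact: IH.
exists n; have DC' : [set: D] #= [set: C] by apply/card_eqPle; split; apply/embedsP.
case: n nD {IH} => [|n] /=; first by move=> AD; exact: card_eq_trans DC'.
move=> [E nE [[ED DE] Emin]]; exists E => //; split.
  split; first by rewrite -(card_le_eqr DC').
  by rewrite -(card_le_eql DC').
by move=> F EF; rewrite -(card_le_eql DC'); exact: Emin.
Qed.

Theorem theorem2 :
  (forall (Lambda : Type) (d : Order.disp_t) (K : orderType d),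
     infinite_set [set: Lambda] ->
     initial_ordinal K ->
     [set: K] #= [set: set (set (set Lambda))] ->
     (exists n : nat, nth_succ_card n Lambda K) ->
     E_omega_carries_non_metacompact K) /\
  (forall (A : Type) (d : Order.disp_t) (K : orderType d),
     aleph_omega A ->
     initial_ordinal K ->
     [set: K] #= [set: set (set (set nat))] ->
     [set: K] #< [set: A] ->
     E_omega_carries_non_metacompact K).
Proof.
have pow3 L : ~ embeds (set (set (set L))) L.
  move=> h; apply: (@not_embeds_set (set (set L))); apply: embeds_trans h _.
  exact: embeds_trans (embeds_set1 L) (embeds_set1 _).
have main (Lambda : Type) (d : Order.disp_t) (K : orderType d) :
    infinite_set [set: Lambda] -> initial_ordinal K ->
    [set: K] #= [set: set (set (set Lambda))] ->
    (exists n : nat, nth_succ_card n Lambda K) ->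
    E_omega_carries_non_metacompact K.
  move=> /infinite_setTP Linf Kini /card_eqPle[/embedsP KL /embedsP LK] [[|n] nK].
    (* By Cantor's theorem [K] is not equipotent with [Lambda], so it is a proper successor and has
       a predecessor [chi]. *)
    case: (pow3 Lambda); apply: embeds_trans LK _.
    by move: nK => /card_eqPle[_ /embedsP].
  by have [chi nchi sK] := nK; exact: E_omega_carries Linf Kini KL LK nchi sK.
split=> // A d K [alephA supA] Kini Kpow [_ /embedsP AK].
have /card_eqPle[_ /embedsP powK] := Kpow.
apply: main Kini Kpow _; first exact: infinite_nat.
(* If [K] is no finite successor of [nat], every aleph_n embeds in [K], hence so does their supremum
   [A], contrary to the bound on [K]. *)
apply: contrapT => nK; apply/AK/embedsP/supA => n B nB; apply/embedsP.
apply: contrapT => BK; apply: nK; apply: nth_succ_below nB _ BK.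
by move=> Knat; apply: (@pow3 nat); exact: embeds_trans Knat.
Qed.
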